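(* Let $1\le s\le n$ with $n\ge2$, and let $\pi_0,\dots,\pi_{s-1}\ge0$ with $\sum_{p=0}^{s-1}\pi_p=1$. Suppose the $n$ keys are distinct, a uniformly random sample of $s$ keys is taken, and the pivot $v$ is chosen as the $(p+1)$th smallest element of the sample with probability $\pi_p$ (so that the number $p_v$ of sample keys smaller than $v$ satisfies $\Pr[p_v=p]=\pi_p$); $v$ is placed in $x_1$ and the remaining $n-1$ keys occupy $x[2\colon n]$ in uniformly random order. For $0\le p<s$ let $T(n,s,p):=\frac{(p+1)(s-p)}{(s+1)(s+2)}\cdot\frac{(n+1)(n+2)}{n-1}-\frac{n}{n-1}$, and define $$E(n,s):=\frac{(\mathbb{E}p_v+1)(n+1)}{s+1}-1,\qquad T(n,s):=\sum_{0\le p<s}\pi_p\,T(n,s,p).$$ Then the average numbers of swaps $T_A,T_B,T_C,T_D$ made by Schemes A, B, C, D (defined in the context), excluding the swaps of their final step, are $$T_A=\frac{\max\{n-3,0\}}{\max\{n-2,1\}}\,T(n,s)+\frac{1}{n-1}E(n,s),\qquad T_B=T_C=T(n,s),\qquad T_D=E(n,s).$$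
   Context: All schemes partition an array $x[1\colon n]$ ($n\ge2$) around the pivot value $v:=x_1$ (the value $v$ is stored, so later comparisons with $v$ use this value even if $x_1$ is moved). A ''swap'' or ''exchange'' $x_a\leftrightarrow x_b$ counts as one swap even if $a=b$. Scheme A: A1. Set $i:=1$, $p':=2$, $j:=n$, $q':=n-1$. If $v>x_j$, exchange $x_i\leftrightarrow x_j$ and set $p':=i$; else if $v<x_j$, set $q':=j$. A2. Increase $i$ by 1; then if $x_i<v$, repeat A2. A3. Decrease $j$ by 1; then if $x_j>v$, repeat A3. A4. If $i<j$, exchange $x_i\leftrightarrow x_j$ and return to A2. If $i=j$, increase $i$ by 1 and decrease $j$ by 1. A5 (final step). If $1<p'$, exchange $x_1\leftrightarrow x_j$; if $q'<n$, exchange $x_i\leftrightarrow x_n$. Scheme B: B1. Set $i:=1$, $j:=n+1$. B2. Increase $i$ by 1; then if $i\le n$ and $x_i<v$, repeat B2. B3. Decrease $j$ by 1; then if $x_j>v$, repeat B3. B4. If $i<j$, exchange $x_i\leftrightarrow x_j$ and return to B2. If $i=j$, increase $i$ by 1 and decrease $j$ by 1. B5 (final step). Exchange $x_1\leftrightarrow x_j$. Scheme C: C1. Set $i:=2$, $j:=n$. C2. If $i\le j$ and $x_i<v$, increase $i$ by 1 and repeat C2. C3. If $i<j$ and $x_j>v$, decrease $j$ by 1 and repeat C3. If $i\ge j$, set $j:=i-1$ and go to C5. C4. Exchange $x_i\leftrightarrow x_j$, increase $i$ by 1, decrease $j$ by 1, return to C2. C5 (final step). Exchange $x_1\leftrightarrow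 x_j$. Scheme D (Lomuto): D1. Set $i:=2$, $p':=1$. D2. If $i>n$, go to D4. D3. If $x_i<v$, increase $p'$ by 1 and exchange $x_{p'}\leftrightarrow x_i$. Increase $i$ by 1 and return to D2. D4 (final step). Exchange $x_1\leftrightarrow x_{p'}$. *)

(* Defs.v *)
From mathcomp Require Import all_boot all_order all_algebra.
From mathcomp Require Import perm.

Set Implicit Arguments.
Unset Strict Implicit.
Unset Printing Implicit Defensive.

Import Order.TTheory GRing.Theory Num.Theory.

Local Open Scope nat_scope.

(* Arrays are 1-based: x[1:n] is given by the values of x : nat -> T at        *)
(* 1, ..., n. The values elsewhere are arbitrary (see [average_swaps]).        *)

Definition exchange (T : Type) (x : nat -> T) (a b : nat) : nat -> T :=
  fun k => if k == a then x b else if k == b then x a else x k.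

Inductive label := L1 | L2 | L3 | L4 | L5 | Done.

(* [Config l i j p q x c]: the scheme is about to execute its step l; i, j, p, *)
(* q are the variables i, j, p', q' (those that a scheme does not use stay 0); *)
(* c is the number of swaps made so far, not counting those of the final step. *)
Record config (T : Type) := Config {
  cfg_label : label;
  cfg_i : nat;
  cfg_j : nat;
  cfg_p : nat;
  cfg_q : nat;
  cfg_array : nat -> T;
  cfg_swaps : nat
}.

Definition start (T : Type) (x : nat -> T) : config T :=
  Config L1 0 0 0 0 x 0.

(* One execution of the current step. The decrements j.-1 and i.-1 are only    *)
(* reached with positive arguments.                                            *)

Definition stepA (d : Order.disp_t) (T : orderType d) (n : nat) (v : T)
    (st : config T) : config T :=
  let: Config l i j p q x c := st in
  match l with
  | L1 => if (x n < v)%O then Config L2 1 n 1 n.-1 (exchange x 1 n) c.+1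
          else if (v < x n)%O then Config L2 1 n 2 n x c
          else Config L2 1 n 2 n.-1 x c
  | L2 => if (x i.+1 < v)%O then Config L2 i.+1 j p q x c
          else Config L3 i.+1 j p q x c
  | L3 => if (v < x j.-1)%O then Config L3 i j.-1 p q x c
          else Config L4 i j.-1 p q x c
  | L4 => if i < j then Config L2 i j p q (exchange x i j) c.+1
          else if i == j then Config L5 i.+1 j.-1 p q x c
          else Config L5 i j p q x c
  | L5 => let y := if 1 < p then exchange x 1 j else x in
          let z := if q < n then exchange y i n else y in
          Config Done i j p q z c
  | Done => st
  end.

Definition stepB (d : Order.disp_t) (T : orderType d) (n : nat) (v : T)
    (st : config T) : config T :=
  let: Config l i j p q x c := st in
  match l with
  | L1 => Config L2 1 n.+1 p q x c
  | L2 => if (i.+1 <= n) && (x i.+1 < v)%O then Config L2 i.+1 j p q x c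
          else Config L3 i.+1 j p q x c
  | L3 => if (v < x j.-1)%O then Config L3 i j.-1 p q x c
          else Config L4 i j.-1 p q x c
  | L4 => if i < j then Config L2 i j p q (exchange x i j) c.+1
          else if i == j then Config L5 i.+1 j.-1 p q x c
          else Config L5 i j p q x c
  | L5 => Config Done i j p q (exchange x 1 j) c
  | Done => st
  end.

Definition stepC (d : Order.disp_t) (T : orderType d) (n : nat) (v : T)
    (st : config T) : config T :=
  let: Config l i j p q x c := st in
  match l with
  | L1 => Config L2 2 n p q x c
  | L2 => if (i <= j) && (x i < v)%O then Config L2 i.+1 j p q x c
          else Config L3 i j p q x c
  | L3 => if (i < j) && (v < x j)%O then Config L3 i j.-1 p q x c
          else if i >= j then Config L5 i i.-1 p q x c
          else Config L4 i j p q x c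
  | L4 => Config L2 i.+1 j.-1 p q (exchange x i j) c.+1
  | L5 => Config Done i j p q (exchange x 1 j) c
  | Done => st
  end.

Definition stepD (d : Order.disp_t) (T : orderType d) (n : nat) (v : T)
    (st : config T) : config T :=
  let: Config l i j p q x c := st in
  match l with
  | L1 => Config L2 2 j 1 q x c
  | L2 => if i > n then Config L4 i j p q x c else Config L3 i j p q x c
  | L3 => if (x i < v)%O
          then Config L2 i.+1 j p.+1 q (exchange x p.+1 i) c.+1
          else Config L2 i.+1 j p q x c
  | L4 => Config Done i j p q (exchange x 1 p) c
  | _ => st
  end.

Definition makes_swaps (T : Type) (step : T -> config T -> config T)
    (x : nat -> T) (k : nat) : Prop :=
  exists m, let st := iter m (step (x 1)) (start x) in
    cfg_label st = Done /\ cfg_swaps st = k.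

(* The keys are indexed by 'I_n. A placement is a permutation sigma of 'I_n:   *)
(* the key of index k is stored at the (1-based) position (sigma k).+1.        *)

Definition placed (T : Type) (n : nat) (key : 'I_n -> T) (sigma : 'S_n)
    (x : nat -> T) : Prop :=
  forall k : 'I_n, x (sigma k).+1 = key k.

Definition sample_rank (d : Order.disp_t) (T : orderType d) (n : nat)
    (key : 'I_n -> T) (S : {set 'I_n}) (k : 'I_n) : nat :=
  #|[set l in S | (key l < key k)%O]|.

Local Open Scope ring_scope.

Definition uniform_mean (R : realFieldType) (I : finType) (A : {set I})
    (f : I -> R) : R :=
  (\sum_(a in A) f a) / #|A|%:R.

(* Expectation of f S k sigma, where S is the sample, k the pivot and sigma    *)
(* the placement. For distinct keys the set of pivots below is a singleton,    *)
(* the (p+1)th smallest element of S.                                          *)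
Definition expect (d : Order.disp_t) (T : orderType d) (R : realFieldType)
    (n s : nat) (key : 'I_n -> T) (pi : 'I_s -> R)
    (f : {set 'I_n} -> 'I_n -> 'S_n -> R) : R :=
  uniform_mean [set S : {set 'I_n} | #|S| == s] (fun S =>
    \sum_(p < s) pi p *
      uniform_mean [set k in S | sample_rank key S k == p] (fun k =>
        uniform_mean [set sigma : 'S_n | sigma k == 0%N :> nat] (fun sigma =>
          f S k sigma))).

(* t is the average of the number of swaps; the scheme terminates on every     *)
(* placement, with a number of swaps that only depends on x[1:n].              *)
Definition average_swaps (d : Order.disp_t) (T : orderType d)
    (R : realFieldType) (n s : nat) (key : 'I_n -> T) (pi : 'I_s -> R)
    (step : T -> config T -> config T) (t : R) : Prop :=
  exists N : 'S_n -> nat,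
    (forall sigma x, placed key sigma x -> makes_swaps step x (N sigma)) /\
    expect key pi (fun _ _ sigma => (N sigma)%:R) = t.

Definition mean_p (d : Order.disp_t) (T : orderType d) (R : realFieldType)
    (n s : nat) (key : 'I_n -> T) (pi : 'I_s -> R) : R :=
  expect key pi (fun S k _ => (sample_rank key S k)%:R).

Definition Ens (d : Order.disp_t) (T : orderType d) (R : realFieldType)
    (n s : nat) (key : 'I_n -> T) (pi : 'I_s -> R) : R :=
  (mean_p key pi + 1) * (n%:R + 1) / (s%:R + 1) - 1.

Definition Tnsp (R : realFieldType) (n s p : nat) : R :=
  ((p%:R + 1) * (s%:R - p%:R)) / ((s%:R + 1) * (s%:R + 2))
    * (((n%:R + 1) * (n%:R + 2)) / (n%:R - 1))
  - n%:R / (n%:R - 1).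

Definition Tns (R : realFieldType) (n s : nat) (pi : 'I_s -> R) : R :=
  \sum_(p < s) pi p * Tnsp R n s p.

(* Main.v *)
Require Import Defs.
From mathcomp Require Import all_boot all_order all_algebra.
From mathcomp Require Import fingroup perm zify ring lra.

Set Implicit Arguments.
Unset Strict Implicit.
Unset Printing Implicit Defensive.

Import Order.TTheory GRing.Theory Num.Theory.
Local Open Scope nat_scope.

(** Let [m] be the number of keys smaller than the pivot [v]. Schemes B and C
exchange each key larger than [v] that lies in [x[2:m+1]] exactly once and move
no other key out of that range, so they make [misplaced] swaps; Scheme D makes
[m] swaps; Scheme A makes one swap if [x_n < v] and then works like Scheme B on
[x[2:n-1]].

Given the pivot, the contents of the positions [2..n] are exchangeable, so each
of them holds a larger key with probability [(n-1-m)/(n-1)]; conditioning on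
[x_n < v] and exchanging the positions [2..n-1] settles Scheme A. Given
[p_v = p], the rank [m] has probability
[C(m,p) C(n-1-m,s-1-p) / C(n,s)], and since [(m+1) C(m,p) = (p+1) C(m+1,p+1)],
the means of [m+1] and [(m+1)(n-m)] are again convolutions of binomials. *)

(** * Sums over intervals and termination of iterated steps *)

Lemma sum_nat_eq_index (a b i c : nat) :
  \sum_(a <= l < b) (l == i) * c = (a <= i < b) * c.
Proof.
rewrite -big_distrl /=; congr (_ * _).
elim: b => [|b IHb]; first by rewrite big_geq // andbF.
case: (leqP a b) => hab; last by rewrite big_geq //; lia.
by rewrite big_nat_recr //= IHb; lia.
Qed.

(** Position [i] loses [F (x i)] and gains [F (x j)], position [j] the reverse. Losses stand on the
    left to avoid truncated subtraction; the indicators cover positions outside [[a, b)]. *)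
Lemma sum_exchange (T : Type) (F : T -> nat) (x : nat -> T) (a b i j : nat) :
  i != j ->
  \sum_(a <= l < b) F (exchange x i j l)
    + (a <= i < b) * F (x i) + (a <= j < b) * F (x j)
  = \sum_(a <= l < b) F (x l)
    + (a <= i < b) * F (x j) + (a <= j < b) * F (x i).
Proof.
move=> ij; rewrite -!sum_nat_eq_index -!big_split /=.
apply: eq_bigr => l _; rewrite /exchange.
by case: (eqVneq l i) (eqVneq l j) => [->|li] [?|lj]; subst;
  rewrite ?eqxx ?(negPf ij) ?mul1n ?mul0n; lia.
Qed.

Lemma sum_nat_all1 (f : nat -> bool) (a b : nat) :
  (forall l, a <= l < b -> f l) -> \sum_(a <= l < b) f l = b - a.
Proof.
move=> hf; rewrite (eq_big_nat _ _ (F2 := fun=> 1)) ?sum_nat_const_nat ?muln1 //.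
by move=> l /hf ->.
Qed.

Lemma sum_nat_all0 (f : nat -> bool) (a b : nat) :
  (forall l, a <= l < b -> ~~ f l) -> \sum_(a <= l < b) f l = 0.
Proof. by move=> hf; apply: big1_seq => l; rewrite mem_index_iota => /hf/negPf->. Qed.

Lemma sum_nat_bool_le (f : nat -> bool) (a b : nat) :
  \sum_(a <= l < b) f l <= b - a.
Proof.
apply: (@leq_trans (\sum_(a <= l < b) 1)); last by rewrite sum_nat_const_nat muln1.
by apply: leq_sum => l _; case: (f l).
Qed.

(** Descent on [mu]. A scheme is a step function without built-in termination, so this supplies the
    run and carries the invariant to its end, where the swap count is read off. *)
Lemma iter_reaches_done (T : Type) (step : config T -> config T)
    (inv : config T -> Prop) (mu : config T -> nat) (st : config T) :
  (forall st, inv st -> cfg_label st <> Done ->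
     inv (step st) /\ mu (step st) < mu st) ->
  inv st -> exists m, cfg_label (iter m step st) = Done /\ inv (iter m step st).
Proof.
move=> hstep; have [k] := ubnP (mu st); elim: k st => // k IHk st hk hinv.
case E: (cfg_label st); last by exists 0.
all: have [|h1 h2] := hstep st hinv; first by rewrite E.
all: have [|m hm] := IHk (step st) _ h1; first by lia.
all: by exists m.+1; rewrite iterSr.
Qed.

(** * Two-pointer partitioning *)

Section Partition.

Variables (d : Order.disp_t) (T : orderType d) (v : T) (h : nat).
Implicit Types (x : nat -> T) (st : config T).

Definition below x := \sum_(2 <= l < h.+1) (x l < v)%O.
(* The threshold [below x] is invariant under exchanges inside the window. *)
Definition misplaced x := \sum_(2 <= l < (below x).+2) (v < x l)%O.

Lemma eq_misplaced x y :
  (forall l, 2 <= l <= h -> x l = y l) -> misplaced x = misplaced y.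
Proof.
move=> xy; rewrite /misplaced.
have -> : below x = below y.
  by apply: eq_big_nat => l hl; rewrite xy //; lia.
(* The threshold is at most [h - 1], so the counted prefix stays inside the window. *)
have := sum_nat_bool_le (fun l => (y l < v)%O) 2 h.+1; rewrite -/(below y) => hb.
by apply: eq_big_nat => l hl; rewrite xy //; lia.
Qed.

(** The smaller keys fill exactly [[2..i-1]], so the threshold falls just before [i] and no larger
    key precedes it. *)
Lemma misplaced_partitioned x i :
  2 <= i <= h.+1 -> (forall l, 2 <= l < i -> (x l < v)%O) ->
  (forall l, i <= l <= h -> (v < x l)%O) -> misplaced x = 0.
Proof.
move=> hi lo hi'; rewrite /misplaced.
have -> : below x = i - 2.
  rewrite /below (@big_cat_nat _ _ _ i) /=; [|lia|lia].
  rewrite sum_nat_all1 // sum_nat_all0 ?addn0 // => l hl.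
  by rewrite -leNgt ltW // hi'; lia.
by apply: sum_nat_all0 => l hl; rewrite -leNgt ltW // lo; lia.
Qed.

(** The prefix [[2..below x + 1]] contains [i] but not [j], so the exchange takes one larger key out
    of it and puts a smaller one in. *)
Lemma misplaced_exchange x i j :
  2 <= i -> i < j -> j <= h -> (forall l, 2 <= l < i -> (x l < v)%O) ->
  (forall l, j < l <= h -> (v < x l)%O) -> (v < x i)%O -> (x j < v)%O ->
  (misplaced (exchange x i j)).+1 = misplaced x.
Proof.
move=> hi ij hj lo hi' xi xj.
have nij : i != j by lia.
have xi0 : (x i < v)%O = false by apply/negbTE; rewrite -leNgt ltW.
have xj0 : (v < x j)%O = false by apply/negbTE; rewrite -leNgt ltW.
have eqb : below (exchange x i j) = below x.
  have := sum_exchange (fun t => (t < v)%O : nat) x 2 h.+1 nij.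
  have -> : 2 <= i < h.+1 by lia.
  have -> : 2 <= j < h.+1 by lia.
  by rewrite /below !mul1n addnAC => /addIn/addIn.
(* The positions before [i] and position [j] hold smaller keys, [i] and the positions after [j] do
   not; only those strictly between are undetermined. *)
have bnd : i.-1 <= below x <= j.-2.
  have -> : below x = i - 2 + \sum_(i.+1 <= l < j) (x l < v)%O + 1.
    rewrite /below (@big_cat_nat _ _ _ i) /=; [|lia|lia].
    rewrite sum_nat_all1 // big_ltn; last lia.
    rewrite xi0 (@big_cat_nat _ _ _ j) /=; [|lia|lia].
    rewrite [X in _ + (_ + (_ + X))]big_ltn; last lia.
    rewrite xj [X in _ + (_ + (_ + (_ + X)))]sum_nat_all0;
      first by rewrite add0n addn0 addnA.
    by move=> l hl; rewrite -leNgt ltW // hi'; lia.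
  by have := sum_nat_bool_le (fun l => (x l < v)%O) i.+1 j; lia.
rewrite /misplaced eqb.
have := sum_exchange (fun t => (v < t)%O : nat) x 2 (below x).+2 nij.
have -> : 2 <= i < (below x).+2 by lia.
have -> : 2 <= j < (below x).+2 = false by lia.
by rewrite xi xj0 !addn0 addn1.
Qed.

Section TwoPointers.

(* Scheme A needs no bound test on [i] because [v <= x_n] throughout; for
   Scheme B the bound test is explicit and [sentinel] is trivial. *)
Variables (step : config T -> config T) (sentinel : (nat -> T) -> Prop).
Hypothesis sentinel_exchange : forall x i j,
  sentinel x -> 2 <= i <= h -> 2 <= j <= h -> sentinel (exchange x i j).
Hypothesis step2 : forall i j p q x c, sentinel x -> i <= h ->
  step (Config L2 i j p q x c) =
  if (i < h) && (x i.+1 < v)%O then Config L2 i.+1 j p q x c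
  else Config L3 i.+1 j p q x c.
Hypothesis step3 : forall i j p q x c,
  step (Config L3 i j p q x c) =
  if (v < x j.-1)%O then Config L3 i j.-1 p q x c else Config L4 i j.-1 p q x c.
Hypothesis step4 : forall i j p q x c,
  step (Config L4 i j p q x c) =
  if i < j then Config L2 i j p q (exchange x i j) c.+1
  else if i == j then Config L5 i.+1 j.-1 p q x c else Config L5 i j p q x c.
Hypothesis step5 : forall i j p q x c,
  exists y, step (Config L5 i j p q x c) = Config Done i j p q y c.

(** [K] is the final count: swaps made plus exchanges still due. The bound on [x 1] is an inequality
    because Scheme A may have moved a smaller key there; it stops the downward scan when nothing
    else does. *)
Definition two_pointer_inv (K : nat) st : Prop :=
  let: Config l i j p q x c := st in
  let common := [/\ sentinel x, (x 1 <= v)%O,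
    forall l, 2 <= l <= h -> x l != v & c + misplaced x = K] in
  match l with
  | L1 => False
  | L2 => [/\ common, 1 <= i, i < j <= h.+1,
      forall l, 2 <= l <= i -> (x l < v)%O
    & forall l, j <= l <= h -> (v < x l)%O]
  | L3 => [/\ common, 2 <= i <= h.+1, i <= j <= h.+1,
      forall l, 2 <= l < i -> (x l < v)%O
    & (forall l, j <= l <= h -> (v < x l)%O) /\ (i <= h -> (v < x i)%O)]
  | L4 => [/\ common, 2 <= i <= h.+1, i <= j.+1 <= h.+1,
      forall l, 2 <= l < i -> (x l < v)%O
    & [/\ forall l, j < l <= h -> (v < x l)%O, i <= h -> (v < x i)%O
      & 2 <= j -> (x j < v)%O]]
  | _ => c = K
  end.

(** A scan step brings the pointers closer and gains 3, enough to pay for a change of label. An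
    exchange leaves them in place, so [L4] has the largest weight. The offset [h.+1] keeps the
    subtraction exact after the pointers cross. *)
Definition two_pointer_measure st : nat :=
  3 * (cfg_j st + h.+1 - cfg_i st) +
  match cfg_label st with L2 => 1 | L3 => 2 | L4 => 4 | L5 => 1 | _ => 0 end.

Lemma two_pointer_step K st :
  two_pointer_inv K st -> cfg_label st <> Done ->
  two_pointer_inv K (step st) /\
  two_pointer_measure (step st) < two_pointer_measure st.
Proof.
case: st => [[] i j p q x c] //=.
- case=> [[sx x1 xv cK] i1 /andP[ij jh] lo hi] _; rewrite step2 //; last lia.
  case: ifP => [/andP[ih xi]|hx]; split; try by rewrite /two_pointer_measure /=; lia.
    have ij1 : i.+1 != j.
      by apply/eqP => E; have := hi i.+1 ltac:(lia); rewrite ltNge ltW.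
    split=> //; first by lia.
    by move=> l hl; case: (eqVneq l i.+1) => [->|hli] //; apply: lo; lia.
  split=> //; [by lia|by lia|split=> //].
  move=> ih; move: hx; rewrite ih /= => /negbT; rewrite -leNgt le_eqVlt.
  by rewrite eq_sym (negPf (xv i.+1 ltac:(lia))).
- case=> [[sx x1 xv cK] /andP[i2 ih] /andP[ij jh] lo [hi xi]] _; rewrite step3.
  case: ifP => hx; split; try by rewrite /two_pointer_measure /=; lia.
    (* If [i = j], the key just below [j] is [x 1] or an already scanned smaller key, so the test
       could not have succeeded. *)
    have nij : i != j.
      apply/eqP => E; move: hx; rewrite -E ltNge.
      case: (eqVneq i 2) => [->|ni2]; first by rewrite x1.
      by rewrite ltW // lo; lia.
    split=> //; [by lia|by lia|split=> //].
    by move=> l hl; case: (eqVneq l j.-1) => [->|hlj] //; apply: hi; lia.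
  split=> //; [by lia|by lia|split=> //].
    by move=> l hl; apply: hi; lia.
  move=> j2; move/negbT: hx; rewrite -leNgt le_eqVlt.
  by rewrite (negPf (xv j.-1 ltac:(lia))).
- case=> [[sx x1 xv cK] /andP[i2 ih] /andP[ij jh] lo [hi xi xj]] _; rewrite step4.
  case: ifP => hij; last first.
    (* At a common position the key would be both larger and smaller than [v]: with distinct keys
       the pointers cross without meeting. *)
    have nij : i == j = false.
      apply/eqP => E; have := xi ltac:(lia).
      by rewrite E ltNge ltW // xj //; lia.
    rewrite nij; split; last by rewrite /two_pointer_measure /=; lia.
    have <- := cK; rewrite (@misplaced_partitioned x i) ?addn0 //; first lia.
    by move=> l hl; apply: hi; lia.
  have lti := xi ltac:(lia); have ltj := xj ltac:(lia).
  split; last by rewrite /two_pointer_measure /=; lia.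
  split; [split| lia | lia | |].
  + by apply: sentinel_exchange => //; lia.
  + by rewrite /exchange !ifN //; lia.
  + move=> l hl; rewrite /exchange; case: ifP => _; first by apply: xv; lia.
    by case: ifP => _; apply: xv; lia.
  + by rewrite -cK -(@misplaced_exchange x i j) //; lia.
  + move=> l hl; rewrite /exchange; case: eqVneq => // li.
    by rewrite ifN; [apply: lo; lia|lia].
  + move=> l hl; rewrite /exchange; case: eqVneq => [|li]; first lia.
    by case: eqVneq => // lj; apply: hi; lia.
- move=> cK _; have [y ->] := step5 i j p q x c; split=> //.
  by rewrite /two_pointer_measure /=; lia.
Qed.

Lemma two_pointer_swaps st :
  two_pointer_inv (cfg_swaps st + misplaced (cfg_array st)) st ->
  exists m, cfg_label (iter m step st) = Done /\
    cfg_swaps (iter m step st) = cfg_swaps st + misplaced (cfg_array st).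
Proof.
move=> hst; have [m] := iter_reaches_done (@two_pointer_step _) hst.
case E: (iter m step st) => [l i j p q x c] /= [el]; rewrite el => cK.
by exists m; rewrite E.
Qed.

End TwoPointers.
End Partition.

(** * Swap counts of the four schemes *)

Section Schemes.

Variables (d : Order.disp_t) (T : orderType d) (n : nat) (x : nat -> T).
Hypothesis n2 : 2 <= n.
Hypothesis x_neq : forall l, 2 <= l <= n -> x l != x 1.
Implicit Type y : nat -> T.

Lemma makes_swaps_after_first_step (step : T -> config T -> config T)
    (k : nat) :
  (exists m, let st := iter m (step (x 1)) (step (x 1) (start x)) in
     cfg_label st = Done /\ cfg_swaps st = k) ->
  makes_swaps step x k.
Proof. by case=> m hm; exists m.+1; rewrite iterSr. Qed.

Lemma schemeB_swaps : makes_swaps (stepB n) x (misplaced (x 1) n x).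
Proof.
apply: makes_swaps_after_first_step.
rewrite [stepB n (x 1) (start x)]/=.
apply: (@two_pointer_swaps _ T (x 1) n (stepB n (x 1)) (fun=> True)) => //=.
- by move=> i j p q y c; eexists.
- by split=> //; try (by lia); move=> l hl; lia.
Qed.

(** After the first step position [n] holds a key at least [v], which stops the upward scan. The
    rest is a two-pointer run on the window [[2..n-1]], which the first exchange has not touched. *)
Lemma schemeA_swaps :
  makes_swaps (stepA n) x ((x n < x 1)%O + misplaced (x 1) n.-1 x).
Proof.
have n1 : n.-1.+1 = n by lia.
apply: makes_swaps_after_first_step.
pose y := if (x n < x 1)%O then exchange x 1 n else x.
(* The values of [p] and [q] act only on the uncounted final step, so they are quantified away. *)
have [p [q ->]] : exists p q, stepA n (x 1) (start x) =
    Config L2 1 n p q y ((x n < x 1)%O : nat).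
  by rewrite /= /y; case: ifP => _; [|case: ifP => _]; do 2 eexists.
have -> : misplaced (x 1) n.-1 x = misplaced (x 1) n.-1 y.
  apply: eq_misplaced => l hl; rewrite /y; case: ifP => // _.
  by rewrite /exchange !ifN //; lia.
apply: (@two_pointer_swaps _ T (x 1) n.-1 (stepA n (x 1))
  (fun z => (x 1 <= z n)%O)) => /=.
- by move=> z i j zn hi hj; rewrite /exchange !ifN //; lia.
- move=> i j p' q' z c zn hi; have [//|hi'] := ltnP i n.-1.
  have -> : i.+1 = n by lia.
  by rewrite ltNge zn.
- by [].
- by [].
- by move=> i j p' q' z c; eexists.
- split=> //; try (by lia); try (by move=> l hl; lia).
  rewrite /y; case: ifP => hx.
    split=> //; first by rewrite /exchange eqxx ifN //; lia.
      by rewrite /exchange eqxx ltW.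
    by move=> l hl; rewrite /exchange !ifN ?x_neq //; lia.
  split=> //; first by rewrite leNgt hx.
  by move=> l hl; apply: x_neq; lia.
Qed.

(** Scheme C tests a position before moving past it, so the known regions are [[2..i-1]] and
    [[j+1..n]] and an exchange moves both pointers. Hence a separate invariant, with the same
    conserved total [K]. *)
Definition schemeC_inv (v : T) (K : nat) (st : config T) : Prop :=
  let: Config l i j p q y c := st in
  let common := [/\ forall l, 2 <= l <= n -> y l != v, c + misplaced v n y = K,
    2 <= i, forall l, 2 <= l < i -> (y l < v)%O
  & forall l, j < l <= n -> (v < y l)%O] in
  match l with
  | L1 => False
  | L2 => common /\ i <= j.+1 <= n.+1
  | L3 => [/\ common, i <= j.+1 <= n.+1 & i <= j -> (v < y i)%O]
  | L4 => [/\ common, i < j <= n, (v < y i)%O & (y j < v)%O]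
  | _ => c = K
  end.

Definition schemeC_measure (st : config T) : nat :=
  2 * (cfg_j st + n.+2 - cfg_i st) +
  match cfg_label st with L2 => 4 | L3 => 3 | L4 => 2 | L5 => 1 | _ => 0 end.

Lemma schemeC_step v K st :
  schemeC_inv v K st -> cfg_label st <> Done ->
  schemeC_inv v K (stepC n v st) /\
  schemeC_measure (stepC n v st) < schemeC_measure st.
Proof.
case: st => [[] i j p q y c] //=.
- case=> [[yv cK i2 lo hi] /andP[ij jn]] _.
  case: ifP => [/andP[ij' yi]|hy];
    split; try by rewrite /schemeC_measure /=; lia.
    split; last lia.
    split=> //; first lia.
    by move=> l hl; case: (eqVneq l i) => [->|li] //; apply: lo; lia.
  split=> //; first lia.
  move=> ij'; move: hy; rewrite ij' /= => /negbT; rewrite -leNgt le_eqVlt.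
  by rewrite eq_sym (negPf (yv i ltac:(lia))).
- case=> [[yv cK i2 lo hi] /andP[ij jn] yi] _.
  case: ifP => [/andP[ij' yj]|hy].
    split; last by rewrite /schemeC_measure /=; lia.
    split; [split=> // | lia | by move=> _; apply: yi; lia].
    by move=> l hl; case: (eqVneq l j) => [->|lj] //; apply: hi; lia.
  case: ifP => hij; split; try by rewrite /schemeC_measure /=; lia.
    rewrite /= -cK (@misplaced_partitioned _ _ _ _ _ i) ?addn0 //; first lia.
    (* If the pointers meet at [i = j], step [L3] has not tested this key, but [L2] has found it
       larger than [v]. *)
    move=> l hl; case: (eqVneq l i) => [E|li]; last by apply: hi; lia.
    case: (ltnP j i) => ji; first by apply: hi; lia.
    by rewrite E; apply: yi.
  split=> //; [lia|by apply: yi; lia|].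
  move: hy; have -> /= : i < j by lia.
  move/negbT; rewrite -leNgt le_eqVlt.
  by rewrite (negPf (yv j ltac:(lia))).
- case=> [[yv cK i2 lo hi] /andP[ij jn] yi yj] _.
  split; last by rewrite /schemeC_measure /=; lia.
  split; last lia.
  split.
  + move=> l hl; rewrite /exchange; case: ifP => _; first by apply: yv; lia.
    by case: ifP => _; apply: yv; lia.
  + by rewrite -cK -(@misplaced_exchange _ _ v n y i j) // addSnnS.
  + lia.
  + move=> l hl; rewrite /exchange; case: eqVneq => // li.
    by rewrite ifN; [apply: lo; lia|lia].
  + move=> l hl; rewrite /exchange; case: eqVneq => [|li]; first lia.
    by case: eqVneq => // lj; apply: hi; lia.
- by move=> cK _; split=> //; rewrite /schemeC_measure /=; lia.
Qed.

Lemma schemeC_swaps : makes_swaps (stepC n) x (misplaced (x 1) n x).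
Proof.
apply: makes_swaps_after_first_step.
rewrite [stepC n (x 1) (start x)]/=.
have [] := iter_reaches_done
  (@schemeC_step (x 1) (misplaced (x 1) n x)) (st := Config L2 2 n 0 0 x 0).
  by split; [split=> // l|]; lia.
move=> m; case E: (iter _ _ _) => [l i j p q y c] /= [el]; rewrite el => cK.
by exists m; rewrite E.
Qed.

(** Exchanges reach only positions up to the current [i], so every later test still sees the input
    array and each key is tested once. *)
Definition schemeD_inv (st : config T) : Prop :=
  let: Config l i j p q y c := st in
  let common := [/\ 1 <= p < i, c = \sum_(2 <= l < i) (x l < x 1)%O
    & forall l, i <= l -> y l = x l] in
  match l with
  | L2 => common /\ i <= n.+1
  | L3 => common /\ i <= n
  | L4 | Done => c = below (x 1) n x
  | _ => False
  end.

Definition schemeD_measure (st : config T) : nat :=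
  2 * (n.+2 - cfg_i st) +
  match cfg_label st with L2 => 2 | L3 => 1 | L4 => 1 | _ => 0 end.

Lemma schemeD_step st :
  schemeD_inv st -> cfg_label st <> Done ->
  schemeD_inv (stepD n (x 1) st) /\
  schemeD_measure (stepD n (x 1) st) < schemeD_measure st.
Proof.
case: st => [[] i j p q y c] //=.
- case=> [[pi cE yx] jn] _.
  case: ifP => hi; split; try by rewrite /schemeD_measure /=; lia.
    by rewrite /= cE /below; congr (\sum_(2 <= l < _) _); lia.
  by split=> //; lia.
- case=> [[pi cE yx] jn] _; rewrite yx //.
  case: ifP => hi; split; try by rewrite /schemeD_measure /=; lia.
    split; last lia.
    split; [lia| by rewrite big_nat_recr /= ?hi -?cE ?addn1 //; lia|].
    by move=> l hl; rewrite /exchange !ifN ?yx //; lia.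
  split; last lia.
  split; [lia| by rewrite big_nat_recr /= ?hi -?cE ?addn0 //; lia|].
  by move=> l hl; apply: yx; lia.
- by move=> cK _; split=> //; rewrite /schemeD_measure /=; lia.
Qed.

Lemma schemeD_swaps : makes_swaps (stepD n) x (below (x 1) n x).
Proof.
apply: makes_swaps_after_first_step.
rewrite [stepD n (x 1) (start x)]/=.
have [] := iter_reaches_done schemeD_step (st := Config L2 2 0 1 0 x 0).
  by split; [split=> //; rewrite big_geq|lia].
move=> m; case E: (iter _ _ _) => [l i j p q y c] /= [el]; rewrite el => cK.
by exists m; rewrite E.
Qed.

End Schemes.

(** * Samples and ranks *)

(** Counts the [(p+q+1)]-subsets of [[0, n)] by their member [m] that has [p] members below it and
    [q] above. The induction uses Pascal's rule. *)
Lemma sum_bin_mul_bin n p q :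
  \sum_(m < n) 'C(m, p) * 'C(n - m.+1, q) = 'C(n, (p + q).+1).
Proof.
elim: n p q => [|n IHn] p q; first by rewrite big_ord0 bin0n.
rewrite big_ord_recr /= subnn; case: q => [|q].
  rewrite addn0 binS -{1}[p in 'C(n, p.+1)]addn0 -IHn bin0 muln1; congr (_ + _).
  by apply: eq_bigr => m _; rewrite !bin0.
rewrite bin0n muln0 addn0 binS -IHn addnS -IHn -big_split /=.
by apply: eq_bigr => m _; rewrite subSn // binS mulnDr.
Qed.

Lemma sum_succ_mul_bins n p q :
  \sum_(m < n) m.+1 * ('C(m, p) * 'C(n - m.+1, q))
  = p.+1 * 'C(n.+1, (p + q).+2).
Proof.
rewrite -addSn -sum_bin_mul_bin big_ord_recl /= mul0n add0n big_distrr /=.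
by apply: eq_bigr => m _; rewrite mulnA (mul_bin_diag m.+1 p) -mulnA.
Qed.

(** The first binomial absorbs [m + 1] and the second [n - m], which gives the convolution for
    [n + 2], [p + 1], [q + 1]; its two extreme terms vanish. *)
Lemma sum_succ_sub_mul_bins n p q :
  \sum_(m < n) (m.+1 * (n - m)) * ('C(m, p) * 'C(n - m.+1, q))
  = p.+1 * q.+1 * 'C(n.+2, (p + q).+3).
Proof.
rewrite -addSn -addnS -sum_bin_mul_bin big_ord_recl /= mul0n add0n.
rewrite big_ord_recr /= subnn muln0 addn0 big_distrr /=.
apply: eq_bigr => m _; rewrite mulnACA (mul_bin_diag m.+1 p).
by rewrite subnS mul_bin_diag mulnACA.
Qed.

Section Ranks.

Variables (d : Order.disp_t) (T : orderType d) (n : nat) (key : 'I_n -> T).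
Hypothesis key_inj : injective key.
Implicit Types (S : {set 'I_n}) (k l : 'I_n).

Definition rank k := sample_rank key setT k.

Lemma sample_rank_lt S k l :
  k \in S -> (key k < key l)%O -> sample_rank key S k < sample_rank key S l.
Proof.
move=> kS kl; apply: proper_card; apply/properP; split.
  by apply/subsetP => i; rewrite !inE => /andP[-> /lt_trans->].
by exists k; rewrite !inE ?kS ?kl ?ltxx ?andbF.
Qed.

Lemma sample_rank_inj S : {in S &, injective (sample_rank key S)}.
Proof.
move=> k l kS lS E; apply: key_inj; apply/eqP.
by case: ltgtP => // /(sample_rank_lt _) => /(_ S); rewrite E ?ltnn => ->.
Qed.

Lemma sample_rank_lt_card S k : k \in S -> sample_rank key S k < #|S|.
Proof.
move=> kS; apply: proper_card; apply/properP; split.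
  by apply/subsetP => i; rewrite !inE => /andP[].
by exists k => //; rewrite !inE ltxx andbF.
Qed.

Lemma rank_ltn k : rank k < n.
Proof. by have := @sample_rank_lt_card setT k (in_setT _); rewrite cardsT card_ord. Qed.

(** Ranks map [S] injectively into [[0, #|S|)], hence onto it, so each value is attained exactly
    once. *)
Lemma card_sample_rank_eq S (p : nat) :
  p < #|S| -> #|[set k in S | sample_rank key S k == p]| = 1.
Proof.
move=> pS; case: (ltnP 0 #|S|) => [S0|]; last lia.
have cS : #|S|.-1.+1 = #|S| by lia.
pose f k : 'I_(#|S|.-1.+1) := inord (sample_rank key S k).
have fE k : k \in S -> f k = sample_rank key S k :> nat.
  by move=> kS; rewrite inordK // cS sample_rank_lt_card.
have finj : {in S &, injective f}.
  move=> k l kS lS /(congr1 (@nat_of_ord _)).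
  by rewrite !fE //; apply: sample_rank_inj.
have fT : f @: S = setT.
  by apply/eqP; rewrite eqEcard subsetT cardsT card_ord card_in_imset // cS leqnn.
have : inord p \in f @: S by rewrite fT inE.
case/imsetP => k kS /(congr1 (@nat_of_ord _)).
rewrite inordK ?cS // fE // => pk.
apply/eqP/cards1P; exists k; apply/setP => l; rewrite !inE.
apply/andP/eqP => [[lS /eqP lp]|->]; last by rewrite pk.
by apply: (sample_rank_inj lS kS); rewrite lp.
Qed.

Lemma sum_rank (R : nmodType) (g : nat -> R) :
  (\sum_k g (rank k) = \sum_(m < n) g m)%R.
Proof.
pose f k : 'I_n := Ordinal (rank_ltn k).
have finj : injective f.
  by move=> k l /(congr1 (@nat_of_ord _)) /=; apply: sample_rank_inj; rewrite inE.
by rewrite [RHS](reindex_inj finj).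
Qed.

(** Such a sample consists of [k], of [p] keys among the smaller ones ([L]) and of [q] among the
    larger ones ([U]). The map [f] assembles it, and intersecting with [L] and [U] recovers the
    parts. *)
Lemma card_samples_rank_eq k p q :
  #|[set S : {set 'I_n} | [&& #|S| == (p + q).+1, k \in S & sample_rank key S k == p]]|
  = 'C(rank k, p) * 'C(n - (rank k).+1, q).
Proof.
pose L := [set l | (key l < key k)%O]; pose U := [set l | (key k < key l)%O].
have cL : #|L| = rank k.
  by apply: eq_card => l; rewrite !inE.
have cU : #|U| = n - (rank k).+1.
  have : L :|: U = [set~ k].
    by apply/setP => l; rewrite !inE -neq_lt (inj_eq key_inj).
  move=> /(congr1 (fun A : {set 'I_n} => #|A|)).
  rewrite cardsC1 card_ord cardsU cL.
  have -> : L :&: U = set0.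
    by apply/setP => l; rewrite !inE; apply/negbTE; rewrite negb_and -!leNgt le_total.
  rewrite cards0 subn0 => E.
  have -> : n - (rank k).+1 = n.-1 - rank k by lia.
  by rewrite -E addKn.
rewrite -cU -cL -!cards_draws -cardsX.
pose f (AB : {set 'I_n} * {set 'I_n}) := k |: (AB.1 :|: AB.2).
have kL : k \notin L by rewrite inE ltxx.
have kU : k \notin U by rewrite inE ltxx.
have LU : [disjoint L & U].
  apply/pred0P => l; rewrite /= !inE; apply/negbTE.
  by rewrite negb_and -!leNgt le_total.
have fL (A B : {set 'I_n}) : A \subset L -> B \subset U -> f (A, B) :&: L = A.
  move=> AL BU; apply/setP => l; rewrite !inE /= -/(l \in L).
  case: (boolP (l \in A)) => [/(subsetP AL) lL|lA] /=.
    by move: (lL); rewrite inE => ->; rewrite orbT.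
  case: (boolP (l \in B)) => [/(subsetP BU)|lB] /=.
    by rewrite inE orbT => kl; apply/negbTE; rewrite -leNgt ltW.
  by rewrite orbF; case: eqP => // ->; rewrite ltxx.
have fU (A B : {set 'I_n}) : A \subset L -> B \subset U -> f (A, B) :&: U = B.
  move=> AL BU; apply/setP => l; rewrite !inE /=.
  case: (boolP (l \in B)) => [/(subsetP BU) lU|lB] /=.
    by move: (lU); rewrite inE => ->; rewrite !orbT.
  case: (boolP (l \in A)) => [/(subsetP AL)|lA] /=.
    by rewrite inE orbT => kl; apply/negbTE; rewrite -leNgt ltW.
  by rewrite orbF; case: eqP => // ->; rewrite ltxx.
have finj : {in setX [set A : {set 'I_n} | A \subset L & #|A| == p]
                     [set B : {set 'I_n} | B \subset U & #|B| == q] &, injective f}.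
  move=> [A B] [A' B']; rewrite !inE /= => /andP[/andP[AL _] /andP[BU _]].
  move=> /andP[/andP[AL' _] /andP[BU' _]] E.
  by rewrite -(fL A B) // -{2}(fU A B) // E fL // fU.
rewrite -(card_in_imset finj); apply: eq_card => S; rewrite inE.
have srE : sample_rank key S k = #|S :&: L|.
  by apply: eq_card => l; rewrite !inE.
have split_S : k \in S -> S = f (S :&: L, S :&: U).
  move=> kS; apply/setP => l; rewrite !inE /= -andb_orr.
  rewrite -neq_lt (inj_eq key_inj); case: eqP => [->|_] /=; first by [].
  by rewrite andbT.
have cf (A B : {set 'I_n}) : A \subset L -> B \subset U ->
    #|f (A, B)| = (#|A| + #|B|).+1.
  move=> AL BU; rewrite cardsU1 !inE /= negb_or.
  rewrite (contra (subsetP AL k) kL) (contra (subsetP BU k) kU) /=.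
  rewrite cardsU; have -> : A :&: B = set0; last by rewrite cards0 subn0.
  by apply/disjoint_setI0; apply: disjointWl AL _; apply: disjointWr BU _.
apply/and3P/imsetP => [[/eqP cS kS /eqP rS]|[[A B]]].
  exists (S :&: L, S :&: U); last exact: split_S.
  rewrite !inE !subsetIr /= -srE rS eqxx /=.
  move: cS; rewrite {1}(split_S kS) cf ?subsetIr // -srE rS => -[] /eqP.
  by rewrite eqn_add2l.
rewrite !inE /= => /andP[/andP[AL /eqP cA] /andP[BU /eqP cB]] SE.
by rewrite srE SE fL // cf // cA cB setU11.
Qed.

End Ranks.

(** * Exchangeability of the placements *)

Section UniformMean.

Local Open Scope ring_scope.
Variables (R : realFieldType) (I : finType) (A : {set I}).

Lemma eq_uniform_mean (f g : I -> R) :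
  {in A, f =1 g} -> uniform_mean A f = uniform_mean A g.
Proof. by move=> fg; rewrite /uniform_mean (eq_bigr g). Qed.

Lemma uniform_meanD (f g : I -> R) :
  uniform_mean A (fun a => f a + g a) = uniform_mean A f + uniform_mean A g.
Proof. by rewrite /uniform_mean big_split mulrDl. Qed.

Lemma uniform_meanZ (c : R) (f : I -> R) :
  uniform_mean A (fun a => c * f a) = c * uniform_mean A f.
Proof. by rewrite /uniform_mean -mulr_sumr mulrA. Qed.

Lemma uniform_mean_sum (J : Type) (r : seq J) (P : pred J) (f : J -> I -> R) :
  uniform_mean A (fun a => \sum_(j <- r | P j) f j a)
  = \sum_(j <- r | P j) uniform_mean A (f j).
Proof. by rewrite /uniform_mean exchange_big /= mulr_suml. Qed.

Lemma uniform_mean_cst (c : R) : (0 < #|A|)%N -> uniform_mean A (fun=> c) = c.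
Proof.
by move=> A0; rewrite /uniform_mean sumr_const -[c *+ _]mulr_natr mulfK //
  pnatr_eq0 -lt0n.
Qed.

End UniformMean.

Section Placements.

Variables (d : Order.disp_t) (T : orderType d) (R : realFieldType) (n' : nat).
Let n := n'.+1.
Variable key : 'I_n -> T.
Hypothesis key_inj : injective key.
Implicit Types (sigma : 'S_n) (k : 'I_n).

Definition pivot_placements k := [set sigma : 'S_n | sigma k == 0 :> nat].

(** A canonical total array realizing [sigma]; indices outside [[1..n]] receive whatever key [l.-1]
    and the default of [inord] produce. *)
Definition placed_array sigma (l : nat) : T := key ((sigma^-1)%g (inord l.-1)).

Lemma card_pivot_placements_gt0 k : 0 < #|pivot_placements k|.
Proof. by apply/card_gt0P; exists (tperm k ord0); rewrite inE tpermL. Qed.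

Lemma placed_arrayE sigma (x : nat -> T) :
  placed key sigma x -> forall l, 1 <= l <= n -> x l = placed_array sigma l.
Proof.
move=> hx l hl; rewrite /placed_array -hx permKV inordK; last lia.
by congr x; lia.
Qed.

Lemma placed_array1 k sigma :
  sigma \in pivot_placements k -> placed_array sigma 1 = key k.
Proof.
rewrite inE => /eqP sk; rewrite /placed_array; congr key.
apply: (@perm_inj _ sigma); rewrite permKV; apply: val_inj.
by rewrite /= inordK.
Qed.

Lemma placed_array_inj sigma l l' : 1 <= l <= n -> 1 <= l' <= n ->
  placed_array sigma l = placed_array sigma l' -> l = l'.
Proof.
move=> hl hl' /key_inj/perm_inj/(congr1 (@nat_of_ord _)).
by rewrite !inordK; lia.
Qed.

(** Links the group action to arrays: invariance of the uniform distribution under multiplication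
    becomes exchangeability of positions. *)
Lemma placed_array_tperm sigma a b l : 1 <= a <= n -> 1 <= b <= n -> 1 <= l <= n ->
  placed_array (sigma * tperm (inord a.-1) (inord b.-1))%g l
  = exchange (placed_array sigma) a b l.
Proof.
move=> ha hb hl; rewrite /placed_array /exchange invMg permM tpermV.
have inordE i : 1 <= i <= n -> (inord l.-1 == inord i.-1 :> 'I_n) = (l == i).
  by move=> hi; rewrite -val_eqE /= !inordK; lia.
case: (eqVneq l a) => [->|la]; first by rewrite tpermL.
case: (eqVneq l b) => [->|lb]; first by rewrite tpermR.
by rewrite tpermD // eq_sym inordE.
Qed.

Lemma sum_placed_array k sigma (F : T -> nat) : sigma \in pivot_placements k ->
  F (key k) + \sum_(2 <= l < n.+1) F (placed_array sigma l) = \sum_l F (key l).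
Proof.
move=> sk; rewrite -(placed_array1 sk) -(@big_ltn _ _ _ 1) //.
rewrite big_add1 /= big_mkord (reindex_inj (@perm_inj _ sigma)) /=.
by apply: eq_bigr => i _; rewrite /placed_array /= inord_val permK.
Qed.

Lemma below_placed_array k sigma : sigma \in pivot_placements k ->
  below (key k) n (placed_array sigma) = rank key k.
Proof.
move=> sk; have := sum_placed_array (fun t => (t < key k)%O : nat) sk.
rewrite ltxx add0n /below => ->.
rewrite /rank /sample_rank -sum1dep_card [RHS]big_mkcond /=.
by apply: eq_bigr => l _; rewrite inE; case: (key l < key k)%O.
Qed.

Lemma above_placed_array k sigma : sigma \in pivot_placements k ->
  \sum_(2 <= l < n.+1) (key k < placed_array sigma l)%O = n - (rank key k).+1.
Proof.
move=> sk; rewrite -(below_placed_array sk) subnS; set A := \sum_(_ <= l < _) _.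
suff : below (key k) n (placed_array sigma) + A = n - 1 by lia.
rewrite /below /A -big_split /= -[RHS](subSS 1 n) -[RHS]muln1 -sum_nat_const_nat.
apply: eq_big_nat => l hl; case: ltgtP => //.
rewrite -(placed_array1 sk) => /placed_array_inj E.
by have := E ltac:(lia) ltac:(lia); lia.
Qed.

Local Open Scope ring_scope.

Definition pivot_mean k (f : 'S_n -> R) := uniform_mean (pivot_placements k) f.

Section Exchangeable.

Variables (k : 'I_n) (h : nat) (w : 'S_n -> R).
Hypothesis hn : (h <= n)%N.
Hypothesis w_tperm : forall sigma a b, (2 <= a <= h)%N -> (2 <= b <= h)%N ->
  w (sigma * tperm (inord a.-1) (inord b.-1))%g = w sigma.

(** Multiplying by the transposition of two window positions permutes the placements that have the
    pivot in position 1. The weight [w] serves for conditioning: it is 1, or an indicator of what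
    position [n] holds. *)
Lemma pivot_mean_position (G : T -> R) a b : (2 <= a <= h)%N -> (2 <= b <= h)%N ->
  pivot_mean k (fun sigma => w sigma * G (placed_array sigma a))
  = pivot_mean k (fun sigma => w sigma * G (placed_array sigma b)).
Proof.
move=> ha hb; rewrite /pivot_mean /uniform_mean; congr (_ / _).
pose t : 'S_n := tperm (inord a.-1) (inord b.-1).
have t0 : t ord0 = ord0 by rewrite tpermD // -val_eqE /= inordK; lia.
rewrite (reindex_inj (mulIg t)) /=; apply: eq_big => sigma.
  rewrite !inE permM -[0%N]/(nat_of_ord (@ord0 n')) !val_eqE.
  by rewrite -[in LHS]t0 (inj_eq perm_inj).
move=> _; rewrite w_tperm // placed_array_tperm; [|lia..].
by rewrite /exchange eqxx.
Qed.

(* All positions of the window contribute equally, so a prefix of length [r]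
   gets the fraction [r / (h - 1)] of the whole. *)
Lemma pivot_mean_prefix (G : T -> R) r : (r < h)%N ->
  (h - 1)%:R * pivot_mean k (fun sigma =>
      w sigma * \sum_(2 <= l < r.+2) G (placed_array sigma l))
  = r%:R * pivot_mean k (fun sigma =>
      w sigma * \sum_(2 <= l < h.+1) G (placed_array sigma l)).
Proof.
move=> rh; case: (leqP h 1) => h1.
  have -> : r = 0%N by lia.
  have -> : (h - 1 = 0)%N by lia.
  by rewrite !mul0r.
pose c := pivot_mean k (fun sigma => w sigma * G (placed_array sigma 2)).
have prefix b : (b <= h.+1)%N -> pivot_mean k (fun sigma =>
    w sigma * \sum_(2 <= l < b) G (placed_array sigma l)) = (b - 2)%:R * c.
  move=> bh; rewrite /pivot_mean.
  under eq_uniform_mean => sigma _ do rewrite mulr_sumr.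
  rewrite uniform_mean_sum (eq_big_nat _ _ (F2 := fun=> c)); last first.
    by move=> l hl; apply: pivot_mean_position; lia.
  by rewrite sumr_const_nat mulr_natl.
rewrite !prefix; [|lia..].
have -> : (r.+2 - 2 = r)%N by lia.
have -> : (h.+1 - 2 = h - 1)%N by lia.
by rewrite mulrCA.
Qed.

End Exchangeable.
End Placements.

(** * Mean counts for a fixed pivot *)

Section PivotMeans.

Local Open Scope ring_scope.
Variables (d : Order.disp_t) (T : orderType d) (R : realFieldType) (n' : nat).
Let n := n'.+1.
Variables (key : 'I_n -> T) (k : 'I_n).
Hypothesis key_inj : injective key.
Hypothesis n2 : (2 <= n)%N.
Let m := rank key k.

Let n1_neq0 : n%:R - 1 != 0 :> R.
Proof. by rewrite subr_eq0 -[1]/(1%:R) eqr_nat; lia. Qed.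

Let above_natr : (n - m.+1)%:R = n%:R - 1 - m%:R :> R.
Proof. by rewrite natrB ?rank_ltn // -natr1; ring. Qed.

Lemma pivot_mean_below :
  pivot_mean k (fun sigma => (below (key k) n (placed_array key sigma))%:R) = m%:R :> R.
Proof.
rewrite /pivot_mean (@eq_uniform_mean _ _ _ _ (fun=> m%:R)).
  by rewrite uniform_mean_cst ?card_pivot_placements_gt0.
by move=> sigma sk; rewrite below_placed_array.
Qed.

(** The prefix has [m] of the [n - 1] positions, and the window always holds [n - 1 - m] larger
    keys. *)
Lemma pivot_mean_misplaced :
  pivot_mean k (fun sigma => (misplaced (key k) n (placed_array key sigma))%:R)
  = m%:R * (n%:R - 1 - m%:R) / (n%:R - 1) :> R.
Proof.
pose G t : R := (key k < t)%O%:R.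
have := @pivot_mean_prefix _ T R n' key k n (fun=> 1) (leqnn _)
  (fun _ _ _ _ _ => erefl) G m (rank_ltn _ _).
rewrite natrB // => E; apply: (mulfI n1_neq0).
rewrite [RHS]mulrCA divff // mulr1.
transitivity ((n%:R - 1) * pivot_mean k (fun sigma => 1 *
    \sum_(2 <= l < m.+2) G (placed_array key sigma l))).
  congr (_ * _); apply: eq_uniform_mean => sigma sk.
  by rewrite mul1r /misplaced below_placed_array // natr_sum.
rewrite E; congr (_ * _).
rewrite /pivot_mean (@eq_uniform_mean _ _ _ _ (fun=> (n - m.+1)%:R)).
  by rewrite uniform_mean_cst ?card_pivot_placements_gt0 // above_natr.
by move=> sigma sk; rewrite mul1r -natr_sum above_placed_array.
Qed.

(** Position [n] behaves like position 2, which is the prefix of length 1. *)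
Lemma pivot_mean_last_below :
  pivot_mean k (fun sigma => (placed_array key sigma n < key k)%O%:R)
  = m%:R / (n%:R - 1) :> R.
Proof.
pose G t : R := (t < key k)%O%:R.
have := @pivot_mean_prefix _ T R n' key k n (fun=> 1) (leqnn _)
  (fun _ _ _ _ _ => erefl) G 1 n2.
have := @pivot_mean_position _ T R n' key k n (fun=> 1) (leqnn _)
  (fun _ _ _ _ _ => erefl) G n 2 ltac:(lia) ltac:(lia).
rewrite natrB // mul1r => E1 E; apply: (mulfI n1_neq0).
rewrite [RHS]mulrCA divff // mulr1.
transitivity ((n%:R - 1) * pivot_mean k (fun sigma => 1 *
    \sum_(2 <= l < 3) G (placed_array key sigma l))).
  congr (_ * _); transitivity (pivot_mean k
      (fun sigma => 1 * G (placed_array key sigma n))).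
    by apply: eq_uniform_mean => sigma _; rewrite mul1r.
  by rewrite E1; apply: eq_uniform_mean => sigma _; rewrite big_nat1.
rewrite E -pivot_mean_below; apply: eq_uniform_mean => sigma _.
by rewrite mul1r -natr_sum.
Qed.

(** Position [n] is outside the window, so a smaller key there lowers the threshold of the window by
    one. *)
Lemma misplaced_window_below_last sigma : sigma \in pivot_placements k ->
  misplaced (key k) n' (placed_array key sigma) =
  (\sum_(2 <= l < (m - (placed_array key sigma n < key k)%O).+2)
     (key k < placed_array key sigma l)%O)%N.
Proof.
move=> sk; rewrite /misplaced /m -(below_placed_array key sk).
by rewrite [below _ n _]/below [\sum_(2 <= l < n.+1) _]big_nat_recr //= addnK.
Qed.

Lemma pivot_mean_misplaced_window :
  pivot_mean k (fun sigma => ((placed_array key sigma n < key k)%O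
     + misplaced (key k) n' (placed_array key sigma))%:R)
  = Num.max (n%:R - 3) 0 / Num.max (n%:R - 2) 1
     * (m%:R * (n%:R - 1 - m%:R) / (n%:R - 1)) + m%:R / (n%:R - 1) :> R.
Proof.
pose w sigma : R := (placed_array key sigma n < key k)%O%:R.
pose G t : R := (key k < t)%O%:R.
have mean_w : pivot_mean k w = m%:R / (n%:R - 1) := pivot_mean_last_below.
have w_tperm sigma a b : (2 <= a <= n')%N -> (2 <= b <= n')%N ->
    w (sigma * tperm (inord a.-1) (inord b.-1))%g = w sigma.
  move=> ha hb; rewrite /w placed_array_tperm; try lia.
  by rewrite /exchange !ifN //; lia.
have window sigma : sigma \in pivot_placements k ->
    \sum_(2 <= l < n'.+1) G (placed_array key sigma l)
    = n%:R - 1 - m%:R - (1 - w sigma).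
  move=> sk; rewrite -above_natr -(above_placed_array key_inj sk).
  rewrite [X in X%:R]big_nat_recr //=.
  rewrite natrD natr_sum -addrA -[LHS]addr0; congr (_ + _).
  rewrite /w; case: ltgtP => [_|_|/esym]; rewrite /= ?subrr ?subr0 ?subrr //.
  rewrite -(placed_array1 key sk) => /(placed_array_inj key_inj) E.
  by have := E ltac:(lia) ltac:(lia); lia.
have w_sqr sigma : w sigma * w sigma = w sigma.
  by rewrite /w; case: (_ < _)%O; rewrite ?mulr1 ?mulr0.
(* [c1] and [c2] are the contributions of the cases [x_n < v] and [x_n > v], whose prefixes have
   lengths [m - 1] and [m]. *)
pose c1 := pivot_mean k (fun sigma =>
  w sigma * \sum_(2 <= l < m.-1.+2) G (placed_array key sigma l)).
pose c2 := pivot_mean k (fun sigma =>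
  (1 - w sigma) * \sum_(2 <= l < m.+2) G (placed_array key sigma l)).
have -> : pivot_mean k (fun sigma => ((placed_array key sigma n < key k)%O
     + misplaced (key k) n' (placed_array key sigma))%:R)
    = pivot_mean k w + (c1 + c2).
  rewrite /pivot_mean -!uniform_meanD; apply: eq_uniform_mean => sigma sk.
  rewrite natrD misplaced_window_below_last // natr_sum; congr (_ + _).
  rewrite /w; case: (_ < _)%O.
    by rewrite mul1r subrr mul0r addr0 subn1.
  by rewrite mul0r add0r subr0 mul1r subn0.
have m_lt : (m < n)%N := rank_ltn key k.
(* If the pivot is the largest key, [x_n > v] is impossible. This case is separate because a prefix
   of length [m] would not fit into the window. *)
have c2_top : m = n' -> c2 = 0.
  move=> mn; rewrite /c2 /pivot_mean (@eq_uniform_mean _ _ _ _ (fun=> 0)).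
    by rewrite uniform_mean_cst ?card_pivot_placements_gt0.
  move=> sigma sk; have := window _ sk.
  rewrite mn /n -natr1 addrK subrr sub0r /w; case: (_ < _)%O.
    by rewrite subrr mul0r.
  move=> E; have : 0 <= - (1 - 0) :> R by rewrite -E; apply: sumr_ge0 => *.
  by rewrite subr0 oppr_ge0 ler10.
(* For [n = 2] the window is empty, and the truncated numerator makes the first summand vanish. *)
have [n2'|n3] := leqP n 2.
  have n'1 : n' = 1%N by lia.
  have -> : c1 = 0.
    rewrite /c1 (_ : m.-1 = 0%N); last lia.
    rewrite /pivot_mean (@eq_uniform_mean _ _ _ _ (fun=> 0)).
      by rewrite uniform_mean_cst ?card_pivot_placements_gt0.
    by move=> sigma _; rewrite big_geq // mulr0.
  have -> : c2 = 0.
    have [m0|m0] := posnP m; last by apply: c2_top; lia.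
    rewrite /c2 m0 /pivot_mean (@eq_uniform_mean _ _ _ _ (fun=> 0)).
      by rewrite uniform_mean_cst ?card_pivot_placements_gt0.
    by move=> sigma _; rewrite big_geq // mulr0.
  rewrite mean_w !addr0 -[LHS]add0r; congr (_ + _).
  have -> : n%:R = 2 :> R by rewrite /n n'1.
  by rewrite max_r ?mul0r // subr_le0 ler_nat.
have n2_gt0 : n%:R - 2 > 0 :> R by rewrite subr_gt0 ltr_nat.
have n3_ge0 : 1 <= n%:R - 2 :> R by rewrite lerBrDr -(natrD _ 1 2) ler_nat.
have hn' : (n' - 1)%:R = n%:R - 2 :> R.
  rewrite -natrB //; congr (_%:R); rewrite /n; lia.
have E1 : (n%:R - 2) * c1 = (m%:R - 1) * (n%:R - 1 - m%:R) * pivot_mean k w.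
  have := @pivot_mean_prefix _ T R n' key k n' w (leqnSn _) w_tperm G m.-1.
  rewrite hn' -/c1 => ->; last lia.
  transitivity (m.-1%:R * ((n%:R - 1 - m%:R) * pivot_mean k w)).
    congr (_ * _); rewrite -uniform_meanZ; apply: eq_uniform_mean => sigma sk.
    by rewrite window //; have := w_sqr sigma; nra.
  (* For [m = 0] the factors [m.-1] and [m - 1] differ, but the mean of [w] is 0. *)
  rewrite mulrA mean_w; have [->|m0] := posnP m; first by rewrite !(mul0r, mulr0).
  by rewrite -subn1 natrB.
have E2 : (n%:R - 2) * c2 = m%:R * (n%:R - 2 - m%:R) * (1 - pivot_mean k w).
  have [mn|mn] := eqVneq m n'.
    have nE : n%:R = m%:R + 1 :> R by rewrite mn natr1.
    have m_neq0 : m%:R != 0 :> R by rewrite pnatr_eq0; lia.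
    by rewrite c2_top // mean_w nE addrK divff // subrr !mulr0.
  have w'_tperm sigma a b : (2 <= a <= n')%N -> (2 <= b <= n')%N ->
      1 - w (sigma * tperm (inord a.-1) (inord b.-1))%g = 1 - w sigma.
    by move=> ha hb; rewrite w_tperm.
  have := @pivot_mean_prefix _ T R n' key k n' (fun sigma => 1 - w sigma)
    (leqnSn _) w'_tperm G m.
  rewrite hn' -/c2 => ->; last lia.
  rewrite -mulrA; congr (_ * _).
  transitivity (pivot_mean k (fun sigma =>
      (n%:R - 2 - m%:R) * (1 + (-1) * w sigma))).
    apply: eq_uniform_mean => sigma sk; rewrite window //.
    by have := w_sqr sigma; nra.
  rewrite /pivot_mean uniform_meanZ uniform_meanD uniform_meanZ.
  by rewrite uniform_mean_cst ?card_pivot_placements_gt0 // mulN1r.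
have n2_neq0 : n%:R - 2 != 0 :> R by rewrite gt_eqF.
apply: (mulfI n2_neq0); rewrite mulrDr mulrDr E1 E2 mean_w.
rewrite !max_l //; last by rewrite subr_ge0 ler_nat.
by field; rewrite n1_neq0.
Qed.
End PivotMeans.

(** * Averaging over samples *)

Section Expectation.

Local Open Scope ring_scope.
Variables (d : Order.disp_t) (T : orderType d) (R : realFieldType) (n' s : nat).
Let n := n'.+1.
Variables (key : 'I_n -> T) (pi : 'I_s -> R).
Hypothesis key_inj : injective key.
Hypothesis s_le_n : (s <= n)%N.
Implicit Types (S : {set 'I_n}) (k : 'I_n) (f : {set 'I_n} -> 'I_n -> 'S_n -> R).

Let card_samples : #|[set S : {set 'I_n} | #|S| == s]| = 'C(n, s).
Proof. by rewrite card_draws card_ord. Qed.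

Let bin_neq0 : 'C(n, s)%:R != 0 :> R.
Proof. by rewrite pnatr_eq0 -lt0n bin_gt0. Qed.

(** The mean over pivots runs over a singleton, so its denominator is 1 and only the number of
    samples remains. *)
Lemma expect_sum_pivots f :
  expect key pi f = \sum_(p < s) pi p *
    ((\sum_(S : {set 'I_n} | #|S| == s)
        \sum_(k in S | sample_rank key S k == p) pivot_mean k (f S k))
     / 'C(n, s)%:R).
Proof.
rewrite /expect {1}/uniform_mean card_samples big_mkcond /=.
transitivity ((\sum_(S : {set 'I_n} | #|S| == s) \sum_(p < s) pi p *
    \sum_(k in S | sample_rank key S k == p) pivot_mean k (f S k)) / 'C(n, s)%:R).
  congr (_ / _); rewrite -big_mkcond /=; apply: eq_big => S; first by rewrite inE.
  rewrite inE => /eqP cS; apply: eq_bigr => p _; congr (_ * _).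
  rewrite {1}/uniform_mean card_sample_rank_eq ?cS // divr1.
  by apply: eq_bigl => k; rewrite inE.
rewrite exchange_big mulr_suml; apply: eq_bigr => p _.
by rewrite -mulr_sumr mulrA.
Qed.

(** The conditional expectation of [g] at the pivot's rank among all keys, given sample rank [p]. *)
Definition rank_mean (g : nat -> R) (p : nat) : R :=
  (\sum_(m < n) g m * ('C(m, p) * 'C(n - m.+1, s - p.+1))%:R) / 'C(n, s)%:R.

(** Summing over samples first, each pivot contributes a number of samples that depends only on its
    rank, and the ranks run once through [[0, n)]. *)
Lemma expect_rank f (g : nat -> R) :
  (forall S k, pivot_mean k (f S k) = g (rank key k)) ->
  expect key pi f = \sum_(p < s) pi p * rank_mean g p.
Proof.
move=> fg; rewrite expect_sum_pivots; apply: eq_bigr => p _; congr (_ * (_ / _)).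
rewrite -(sum_rank key_inj (fun m => g m * ('C(m, p) * 'C(n - m.+1, s - p.+1))%:R)) /=.
transitivity (\sum_(S : {set 'I_n} | #|S| == s) \sum_k
   if (k \in S) && (sample_rank key S k == p) then g (rank key k) else 0).
  apply: eq_bigr => S _; rewrite -big_mkcond /=.
  by apply: eq_bigr => k _; rewrite fg.
rewrite exchange_big /=; apply: eq_bigr => k _; rewrite -big_mkcondr /=.
have sE : (p + (s - p.+1)).+1 = s by have := ltn_ord p; lia.
rewrite -card_samples_rank_eq // sE sumr_const -[g _ *+ _]mulr_natr; congr (_ * _%:R).
by apply: eq_card => S; rewrite !inE.
Qed.

Lemma mean_pE : mean_p key pi = \sum_(p < s) pi p * p%:R.
Proof.
rewrite /mean_p expect_sum_pivots; apply: eq_bigr => p _; congr (_ * _).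
transitivity ((\sum_(S : {set 'I_n} | #|S| == s) p%:R) / 'C(n, s)%:R : R).
  congr (_ / _); apply: eq_bigr => S /eqP cS.
  transitivity (\sum_(k in [set k in S | sample_rank key S k == p]) p%:R : R).
    apply: eq_big => k; first by rewrite inE.
    move=> /andP[_ /eqP rk]; rewrite /pivot_mean uniform_mean_cst ?rk //.
    exact: card_pivot_placements_gt0.
  by rewrite sumr_const card_sample_rank_eq ?cS.
rewrite sumr_const -[p%:R *+ _]mulr_natr -card_samples cardsE mulfK //.
by have := bin_neq0; rewrite -card_samples cardsE.
Qed.

(** * Moments of the pivot's rank *)

Section RankMoments.

Variable p : nat.
Hypothesis p_lt : (p < s)%N.
Let q := (s - p.+1)%N.
Let pqs : (p + q).+1 = s. Proof. by rewrite /q; lia. Qed.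

Lemma rank_meanD (g h : nat -> R) :
  rank_mean (fun m => g m + h m) p = rank_mean g p + rank_mean h p.
Proof.
rewrite /rank_mean -mulrDl -big_split; congr (_ / _).
by apply: eq_bigr => m _; rewrite mulrDl.
Qed.

Lemma rank_meanZ (c : R) (g : nat -> R) :
  rank_mean (fun m => c * g m) p = c * rank_mean g p.
Proof.
rewrite /rank_mean mulrA mulr_sumr; congr (_ / _).
by apply: eq_bigr => m _; rewrite mulrA.
Qed.

Lemma eq_rank_mean (g h : nat -> R) :
  (forall m, (m < n)%N -> g m = h m) -> rank_mean g p = rank_mean h p.
Proof. by move=> gh; congr (_ / _); apply: eq_bigr => m _; rewrite gh. Qed.

Lemma rank_mean_nat (g : nat -> nat) :
  rank_mean (fun m => (g m)%:R) p
  = (\sum_(m < n) g m * ('C(m, p) * 'C(n - m.+1, q)))%N%:R / 'C(n, s)%:R.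
Proof.
by rewrite /rank_mean natr_sum; congr (_ / _); apply: eq_bigr => m _;
  rewrite [RHS]natrM.
Qed.

Lemma rank_mean1 : rank_mean (fun=> 1) p = 1.
Proof.
rewrite (rank_mean_nat (fun=> 1%N)).
under eq_bigr => m _ do rewrite mul1n.
by rewrite sum_bin_mul_bin pqs divff.
Qed.

Let binS_natr (a b : nat) :
  'C(a.+1, b.+1)%:R = a.+1%:R / b.+1%:R * 'C(a, b)%:R :> R.
Proof.
have b1 : b.+1%:R != 0 :> R by rewrite pnatr_eq0.
apply: (mulfI b1); rewrite mulrA mulrCA divff // mulr1 -!natrM.
by rewrite mul_bin_diag.
Qed.

Lemma rank_mean_succ :
  rank_mean (fun m => m.+1%:R) p = (p%:R + 1) * (n%:R + 1) / (s%:R + 1).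
Proof.
rewrite (rank_mean_nat succn) sum_succ_mul_bins pqs natrM binS_natr !natr1.
by rewrite -!mulrA divff // mulr1 mulrA.
Qed.

Lemma rank_mean_succ_sub :
  rank_mean (fun m => (m.+1 * (n - m))%:R) p
  = (p%:R + 1) * (s%:R - p%:R) / ((s%:R + 1) * (s%:R + 2))
    * ((n%:R + 1) * (n%:R + 2)).
Proof.
rewrite rank_mean_nat sum_succ_sub_mul_bins pqs !natrM !binS_natr.
have -> : s%:R - p%:R = q.+1%:R :> R.
  by rewrite -natrB; [congr _%:R; lia|lia].
rewrite !natr1 -!(natrD _ _ 2) !addn2.
have h1 : s.+1%:R != 0 :> R by rewrite pnatr_eq0.
have h2 : s.+2%:R != 0 :> R by rewrite pnatr_eq0.
move: h1 h2 bin_neq0; move: (s.+1%:R : R) (s.+2%:R : R) ('C(n, s)%:R : R).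
by move=> a b c a0 b0 c0; field; rewrite a0 b0.
Qed.

Lemma rank_mean_id :
  rank_mean (fun m => m%:R) p = (p%:R + 1) * (n%:R + 1) / (s%:R + 1) - 1.
Proof.
rewrite -rank_mean_succ -[X in _ - X]rank_mean1 -mulN1r -rank_meanZ -rank_meanD.
by apply: eq_rank_mean => m _; rewrite mulN1r -natr1 addrK.
Qed.

Lemma rank_mean_inversions : (2 <= n)%N ->
  rank_mean (fun m => m%:R * (n%:R - 1 - m%:R) / (n%:R - 1)) p = Tnsp R n s p.
Proof.
move=> n2; have n1 : n%:R - 1 != 0 :> R.
  by rewrite subr_eq0 -[1]/(1%:R) eqr_nat; lia.
(* This is [m (n-1-m) = (m+1)(n-m) - n] divided by [n - 1]; the factor 1 is kept for
   [rank_mean1]. *)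
pose u m := (n%:R - 1)^-1 * (m.+1 * (n - m))%:R + (- (n%:R / (n%:R - 1))) * 1 : R.
rewrite (@eq_rank_mean _ u).
  rewrite rank_meanD !rank_meanZ rank_mean1 rank_mean_succ_sub mulr1 /Tnsp.
  by congr (_ - _); rewrite mulrC [RHS]mulrA.
move=> m mn; rewrite /u natrM natrB; last exact: ltnW.
by rewrite -natr1; field; rewrite n1.
Qed.

End RankMoments.

Hypothesis pi_sum : \sum_(p < s) pi p = 1.

Lemma EnsE : Ens key pi = \sum_(p < s) pi p * rank_mean (fun m => m%:R) p.
Proof.
under eq_bigr => p _ do rewrite rank_mean_id //.
rewrite /Ens mean_pE -mulrA; set c := (n%:R + 1) / (s%:R + 1).
transitivity ((\sum_(p < s) pi p * p%:R) * c + (\sum_(p < s) pi p) * c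
              - \sum_(p < s) pi p); first by rewrite pi_sum mulrDl.
rewrite !mulr_suml -big_split -sumrB; apply: eq_bigr => p _ /=.
by rewrite -[X in _ = _ * (X - _)]mulrA -/c; ring.
Qed.

End Expectation.

(** * Average swap counts of the four schemes *)

Local Open Scope ring_scope.

Theorem theorem2 (d : Order.disp_t) (T : orderType d) (R : realFieldType)
    (n s : nat) (hn : (2 <= n)%N) (hs : (1 <= s <= n)%N)
    (pi : 'I_s -> R) (pi_ge0 : forall p, 0 <= pi p)
    (pi_sum : \sum_(p < s) pi p = 1)
    (key : 'I_n -> T) (key_inj : injective key) :
  [/\ average_swaps key pi (stepA n)
        (Num.max (n%:R - 3) 0 / Num.max (n%:R - 2) 1 * Tns n pi
         + 1 / (n%:R - 1) * Ens key pi),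
      average_swaps key pi (stepB n) (Tns n pi),
      average_swaps key pi (stepC n) (Tns n pi)
    & average_swaps key pi (stepD n) (Ens key pi)].
Proof.
case: n hn hs key key_inj => [//|n] hn hs key key_inj.
have sn : (s <= n.+1)%N by case/andP: hs.
have placed_neq sigma x : placed key sigma x ->
    forall l, (2 <= l <= n.+1)%N -> x l != x 1.
  move=> /placed_arrayE hx l hl; rewrite !hx; try lia.
  by apply/eqP => /placed_array_inj -/(_ key_inj) E;
    have := E ltac:(lia) ltac:(lia); lia.
have eq_misplaced_placed sigma x h : (h <= n.+1)%N -> placed key sigma x ->
    misplaced (placed_array key sigma 1) h (placed_array key sigma)
    = misplaced (x 1) h x.
  move=> hh /placed_arrayE hx; rewrite hx //.
  by apply: eq_misplaced => l hl; rewrite hx //; lia.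
have expect_misplaced : expect key pi (fun _ _ sigma =>
    (misplaced (placed_array key sigma 1) n.+1 (placed_array key sigma))%:R)
    = Tns n.+1 pi.
  rewrite (expect_rank pi key_inj sn (g := fun m =>
    m%:R * (n.+1%:R - 1 - m%:R) / (n.+1%:R - 1))) => [|_ k].
    by apply: eq_bigr => p _; rewrite rank_mean_inversions.
  rewrite -pivot_mean_misplaced //; apply: eq_uniform_mean => sigma sk.
  by rewrite (placed_array1 key sk).
split.
(* The count must be a function of the placement alone, so it is read off the canonical array, which
   agrees with [x] on [[1..n]]. *)
- exists (fun sigma => (placed_array key sigma n.+1 < placed_array key sigma 1)%O
    + misplaced (placed_array key sigma 1) n (placed_array key sigma))%N.
  split=> [sigma x hx|].
    rewrite (eq_misplaced_placed _ x) // -!(placed_arrayE hx) //; try lia.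
    by apply: schemeA_swaps => //; apply: placed_neq hx.
  set a := Num.max _ _ / _.
  rewrite (expect_rank pi key_inj sn (g := fun m =>
    a * (m%:R * (n.+1%:R - 1 - m%:R) / (n.+1%:R - 1))
    + 1 / (n.+1%:R - 1) * m%:R)) => [|_ k].
    rewrite (EnsE key_inj sn pi_sum) /Tns !mulr_sumr -big_split.
    apply: eq_bigr => p _; rewrite rank_meanD !rank_meanZ rank_mean_inversions //.
    by rewrite mulrDr ![pi p * (_ * _)]mulrCA.
  rewrite div1r [_^-1 * (rank key k)%:R]mulrC -pivot_mean_misplaced_window //.
  apply: eq_uniform_mean => sigma sk.
  by rewrite (placed_array1 key sk).
- eexists; split; last exact: expect_misplaced.
  move=> sigma x hx; rewrite /= (eq_misplaced_placed _ x) //.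
  by apply: schemeB_swaps => //; apply: placed_neq hx.
- eexists; split; last exact: expect_misplaced.
  move=> sigma x hx; rewrite /= (eq_misplaced_placed _ x) //.
  by apply: schemeC_swaps => //; apply: placed_neq hx.
exists (fun sigma => below (placed_array key sigma 1) n.+1 (placed_array key sigma)).
split=> [sigma x hx|].
  have -> : below (placed_array key sigma 1) n.+1 (placed_array key sigma)
      = below (x 1) n.+1 x.
    by apply: eq_big_nat => l hl; rewrite !(placed_arrayE hx) //; lia.
  exact: schemeD_swaps.
rewrite (expect_rank pi key_inj sn (g := fun m => m%:R)) => [|_ k].
  by rewrite (EnsE key_inj sn pi_sum).
rewrite -(pivot_mean_below R key k).
by apply: eq_uniform_mean => sigma sk; rewrite (placed_array1 key sk).
Qed.
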